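(* The mechanism VCGEV (VCG with Execution Verification, defined in the context) is incentive compatible: for every player $i\in N$, every profile $f=(f_i,f_{-i})\in\mathcal{F}$ (where $f_i$ is the true execution-time distribution of $i$ and $f_{-i}$ are the reports of the others) and every report $f_i'\in\mathcal{F}_i$, $$U_i\big(f_i;(f_i,f_{-i})\big)\ \ge\ U_i\big(f_i;(f_i',f_{-i})\big),$$ where $U_i(f_i;g)$ denotes the expected VCGEV reward of player $i$ when the report profile is $g$ and the true distribution of $i$ is $f_i$.
   Context: Setting. A project consists of tasks $T=(\tau_1,\dots,\tau_m)$ executed one after another in order, with deadline $d$. Players $N=\{1,\dots,n\}$ are partitioned into nonempty disjoint groups $N_{\tau_1},\dots,N_{\tau_m}$; a player in $N_{\tau_j}$ can only perform task $\tau_j$. Player $i$'s execution time is a random variable $E_i$ with values in $\{1,2,\dots\}$ and probability mass function $f_i$; the execution times of different players are independent. Player $i$ privately knows $f_i$ and reports some probability mass function; $\mathcal{F}_i$ is the set of possible probability mass functions of $i$ and $\mathcal{F}=\mathcal{F}_1\times\dots\times\mathcal{F}_n$. Each task is assigned to at most one player. Assignments and values. For a profile $g$ and a coalition $S\subseteq N$, $v(S,g)$ is the highest probability, over all assignments of tasks to players of $S$ able to perform them, that all tasks are assigned and the sum of the execution times of the assigned players (distributed according to $g$) is at most $d$ (so $v(S,g)=0$ if $S$ contains no player for some task). $v(N\setminus\{i\},g_{-i})$ means $v(N\setminus\{i\},g)$, which does not depend on $g_i$. $\pi_S^{g}:T\to N\cup\{\perp\}$ is the chosen optimal assignment attaining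 $v(S,g)$, where $\perp$ means unassigned. For another profile $h$, $v(\pi_S^{g},h)$ is the probability that all tasks are finished by the deadline when the assignment is $\pi_S^g$ but the execution times are distributed according to $h$ (it is $0$ if some task is unassigned). VCGEV mechanism. Let $g$ be the report profile. If $i$ is assigned a task under $\pi_N^g$ and her realized execution time is $e_i$, her reward is $$x_i(g,e_i)=v(\pi_N^{g},(f_i^{e_i},g_{-i}))-v(N\setminus\{i\},g_{-i}),$$ where $f_i^{e_i}$ is the point mass at $e_i$. Otherwise her reward is $0$. Expected reward. $U_i(f_i;g)=\sum_{e\ge 1} f_i(e)\,x_i(g,e)$ if $i$ is assigned a task under $\pi_N^g$, and $U_i(f_i;g)=0$ otherwise. *)

(* Defs.v *)
From mathcomp Require Import all_boot all_order all_algebra.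
From mathcomp Require Import all_classical all_reals all_analysis.

Set Implicit Arguments.
Unset Strict Implicit.
Unset Printing Implicit Defensive.

Import Order.TTheory GRing.Theory Num.Theory.
Import numFieldNormedType.Exports.

Local Open Scope ring_scope.
Local Open Scope classical_set_scope.

Section Project.

Variables (R : realType) (n m : nat).

(* Players are 'I_n and tasks are 'I_m; [grp j] is the set of the players able
   to perform task j. *)
Definition task_groups (grp : 'I_m -> {set 'I_n}) : Prop :=
  [/\ forall j, grp j != finset.set0,
      forall j k, j != k -> (grp j :&: grp k)%SET = finset.set0
    & forall i, exists j, i \in grp j].

Definition is_pmf (p : nat -> R) : Prop :=
  [/\ forall k, 0 <= p k,
      p 0%N = 0
    & (\sum_(0 <= k <oo) (p k)%:E)%E = 1%E].

Definition point_mass (e : nat) : nat -> R := fun k => (k == e)%:R.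

Definition profile := 'I_n -> nat -> R.

Definition replace (g : profile) (i : 'I_n) (p : nat -> R) : profile :=
  fun k => if k == i then p else g k.

Definition in_domain (F : 'I_n -> set (nat -> R)) (g : profile) : Prop :=
  forall i, F i (g i).

(* Probability of the event A about the vector of the execution times of all
   the players: by independence, the joint mass function of that vector is the
   product of the individual ones. *)
Definition Pr (g : profile) (A : set {ffun 'I_n -> nat}) : R :=
  fine (\esum_(x in A) (\prod_(i < n) g i (x i))%:E)%E.

(* [None] stands for "unassigned". *)
Definition assignment := {ffun 'I_m -> option 'I_n}.

Definition assignment_within (grp : 'I_m -> {set 'I_n}) (S : {set 'I_n})
    (a : assignment) : bool :=
  [forall j, if a j is Some i then (i \in S) && (i \in grp j) else true].

Definition assigned (a : assignment) (i : 'I_n) : bool :=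
  [exists j, a j == Some i].

Definition complete (a : assignment) : bool := [forall j, a j != None].

Definition on_time (d : R) (a : assignment) : set {ffun 'I_n -> nat} :=
  [set x : {ffun 'I_n -> nat} |
    complete a /\ (\sum_(i < n | assigned a i) x i)%N%:R <= d].

Definition success (d : R) (a : assignment) (g : profile) : R :=
  Pr g (on_time d a).

(* The base value 0 of the maximum is harmless, as all the probabilities are
   nonnegative. *)
Definition coalition_value (grp : 'I_m -> {set 'I_n}) (d : R)
    (S : {set 'I_n}) (g : profile) : R :=
  \big[Num.max/0]_(a : assignment | assignment_within grp S a) success d a g.

Definition choice_rule := {set 'I_n} -> profile -> assignment.

Definition optimal_rule (grp : 'I_m -> {set 'I_n}) (d : R)
    (F : 'I_n -> set (nat -> R)) (pi : choice_rule) : Prop :=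
  forall S g, in_domain F g ->
    assignment_within grp S (pi S g) /\
    success d (pi S g) g = coalition_value grp d S g.

(* [coalition_value grp d [set~ i]%SET g] is v(N \ {i}, g_{-i}): the report
   [g i] is irrelevant to it. *)
Definition vcgev_reward (grp : 'I_m -> {set 'I_n}) (d : R) (pi : choice_rule)
    (i : 'I_n) (g : profile) (e : nat) : R :=
  if assigned (pi [set: 'I_n]%SET g) i then
    success d (pi [set: 'I_n]%SET g) (replace g i (point_mass e))
    - coalition_value grp d [set~ i]%SET g
  else 0.

Definition vcgev_utility (grp : 'I_m -> {set 'I_n}) (d : R) (pi : choice_rule)
    (i : 'I_n) (p : nat -> R) (g : profile) : R :=
  if assigned (pi [set: 'I_n]%SET g) i then
    limn (fun K => \sum_(1 <= e < K) p e * vcgev_reward grp d pi i g e)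
  else 0.

End Project.

(* Main.v *)
(** By the law of total probability, averaging the success probability over the
    point masses of the execution times of player i, weighted by her true law
    [f i], gives the success probability under the true law. So whenever i is
    assigned, her expected reward is [success (pi g) (f i, f_-i) - W], where
    [W], the value of the other players, does not depend on her report. The
    truthful report makes [pi] maximize the first term, and it yields at least
    [0]: an optimal assignment that leaves i out is available to the others. *)

Require Import Defs.
From mathcomp Require Import all_boot all_order all_algebra.
From mathcomp Require Import all_classical all_reals all_analysis.

Set Implicit Arguments.
Unset Strict Implicit.
Unset Printing Implicit Defensive.

Import Order.TTheory GRing.Theory Num.Theory.
Import numFieldNormedType.Exports.

Local Open Scope ring_scope.

(** * Sums over sets and series in the extended reals *)

Lemma esumZl (R : realType) (T : choiceType) (A : set T) (c : R)
    (a : T -> \bar R) :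
  0 <= c -> (forall x, 0 <= a x)%E ->
  (\esum_(x in A) (c%:E * a x) = c%:E * \esum_(x in A) a x)%E.
Proof.
move=> c0 a0; rewrite /esum -ereal_supZl//; last first.
  apply/set0P; exists 0%E; exists set0; first exact: fsets_set0.
  by rewrite fsbig_set0.
rewrite image_comp; congr ereal_sup; apply: eq_imagel => X _ /=.
by rewrite ge0_mule_fsumr.
Qed.

(** Links pmf series, extended-real and indexed from 0, to the real partial sums from 1 in
    [vcgev_utility]; [u 0 = 0] absorbs the index shift. *)
Lemma cvg_nneseries_fin (R : realType) (u : nat -> R) (l : R) :
  (forall e, 0 <= u e) -> u 0%N = 0 ->
  (\sum_(0 <= e <oo) (u e)%:E = l%:E)%E ->
  ((fun K => \sum_(1 <= e < K) u e) @ \oo --> l)%classic.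
Proof.
move=> u0 u00 ul.
have : ((fun K => \sum_(0 <= e < K) (u e)%:E)%E @ \oo --> l%:E)%classic.
  by rewrite -ul; apply: is_cvg_nneseries => e _ _; rewrite lee_fin.
move=> /fine_cvg; rewrite (_ : _ \o _ = fun K => \sum_(1 <= e < K) u e)//.
apply/funext => -[|K] /=; first by rewrite !big_geq.
by rewrite sumEFin /= big_ltn// u00 add0r.
Qed.

(** * The joint law of independent execution times *)

Section JointLaw.

Variables (R : realType) (n : nat).
Implicit Types (g : profile R n) (A : set {ffun 'I_n -> nat}).

Definition joint g (x : {ffun 'I_n -> nat}) : R := \prod_(k < n) g k (x k).

Definition is_pmf_profile g := forall k, is_pmf (g k).

Lemma is_pmf_ge0 (p : nat -> R) e : is_pmf p -> 0 <= p e.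
Proof. by case. Qed.

Lemma is_pmf_point_mass e : (0 < e)%N -> is_pmf (point_mass R e).
Proof.
move=> e0; split=> [k||]; rewrite /point_mass.
- by rewrite ler0n.
- by rewrite eqn_leq [(e <= _)%N]leqNgt e0 andbF.
- rewrite (nneseriesD1 (n := e))//= ?eqxx.
  by rewrite eseries0 ?adde0// => k _ /negPf ->.
Qed.

Lemma is_pmf_replace g i p :
  is_pmf_profile g -> is_pmf p -> is_pmf_profile (replace g i p).
Proof. by move=> gP pP k; rewrite /replace; case: ifP. Qed.

Lemma replaceE g i : replace g i (g i) = g.
Proof. by apply/funext => k; rewrite /replace; case: eqP => [->|]. Qed.

Lemma replaceK g i p q : replace (replace g i p) i q = replace g i q.
Proof. by apply/funext => k; rewrite /replace; case: eqP. Qed.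

Lemma joint_ge0 g x : is_pmf_profile g -> 0 <= joint g x.
Proof. by move=> gP; apply: prodr_ge0 => k _; exact: is_pmf_ge0. Qed.

Lemma joint_replace g i p x :
  joint (replace g i p) x = p (x i) * \prod_(k < n | k != i) g k (x k).
Proof.
rewrite /joint (bigD1 i)//= /replace eqxx; congr (_ * _).
by apply: eq_bigr => k /negPf ->.
Qed.

Lemma sum_pmf_le1 (p : nat -> R) M : is_pmf p -> \sum_(e < M) p e <= 1.
Proof.
case=> p0 _ p1; rewrite -lee_fin -p1 -sumEFin -(big_mkord xpredT (EFin \o p)).
by apply: nneseries_lim_ge => e _ _; rewrite lee_fin.
Qed.

Lemma esum_joint_le1 g A :
  is_pmf_profile g -> (\esum_(x in A) (joint g x)%:E <= 1)%E.
Proof.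
move=> gP; apply: ge_ereal_sup => _ [X [finX _] <-].
(* A finite set of vectors lies in a box, whose mass is a product of partial
   sums of the individual mass functions. *)
pose M := (\max_(x <- finmap.enum_fset (fset_set X)) \max_(k < n) x k).+1.
pose emb (y : {ffun 'I_n -> 'I_M}) : {ffun 'I_n -> nat} :=
  [ffun k => nat_of_ord (y k)].
have emb_inj : set_inj [set: {ffun 'I_n -> 'I_M}] emb.
  move=> y z _ _ yz; apply/ffunP => k; apply: val_inj.
  by have := congr1 (fun f : {ffun _ -> _} => f k) yz; rewrite !ffunE.
apply: (@le_trans _ _ (\sum_(x \in [set emb y | y in [set: {ffun 'I_n -> 'I_M}]])
    (joint g x)%:E)%E).
  apply: lee_fsum_nneg_subset => //.
  - by apply: finite_image; exact: finite_finset.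
  - move=> x xX; rewrite inE/=.
    have xM k : (x k < M)%N.
      rewrite ltnS.
      apply: leq_trans (@leq_bigmax_seq _ _ xpredT
        (fun x : {ffun 'I_n -> nat} => \max_(k < n) x k) x _ _) => //.
        exact: (@leq_bigmax _ (fun k => x k) k).
      by rewrite in_fset_set.
    exists [ffun k => Ordinal (xM k)] => //.
    by apply/ffunP => k; rewrite !ffunE.
  - by move=> x _; rewrite lee_fin joint_ge0.
rewrite fsbig_image// -set_true.
rewrite -(@bigfs _ _ _ _ (index_enum {ffun 'I_n -> 'I_M}) predT); last 2 first.
- exact: index_enum_uniq.
- by move=> y _; rewrite mem_index_enum.
rewrite sumEFin lee_fin /joint.
under eq_bigr do under eq_bigr do rewrite ffunE.
rewrite -(bigA_distr_bigA (fun k (e : 'I_M) => g k e)).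
apply: prodr_ile1 => k _; rewrite sum_pmf_le1// andbT.
by apply: sumr_ge0 => e _; exact: is_pmf_ge0.
Qed.

Lemma esum_joint_fin_num g A :
  is_pmf_profile g -> \esum_(x in A) (joint g x)%:E \is a fin_num.
Proof.
move=> gP; rewrite ge0_fin_numE.
  by rewrite (le_lt_trans (esum_joint_le1 A gP))// ltry.
by apply: esum_ge0 => x _; rewrite lee_fin joint_ge0.
Qed.

(** The total mass is at most 1, so [fine] in [Pr] loses nothing. *)
Lemma PrE g A : is_pmf_profile g ->
  (Pr g A)%:E = \esum_(x in A) (joint g x)%:E.
Proof. by move=> gP; rewrite fineK// esum_joint_fin_num. Qed.

Lemma Pr_ge0 g A : is_pmf_profile g -> 0 <= Pr g A.
Proof.
by move=> gP; apply/fine_ge0/esum_ge0 => x _; rewrite lee_fin joint_ge0.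
Qed.

(** Tonelli for nonnegative terms: once the sum over [e] is moved inside, each vector [x] keeps only
    the term [e = x i], whose weight is [p (x i)]. *)
Lemma Pr_replace g i p A : is_pmf_profile g -> is_pmf p ->
  (\sum_(0 <= e <oo) (p e * Pr (replace g i (point_mass R e)) A)%:E =
   (Pr (replace g i p) A)%:E)%E.
Proof.
move=> gP pP.
have p0 e : 0 <= p e by exact: is_pmf_ge0.
have q0 x : 0 <= \prod_(k < n | k != i) g k (x k).
  by apply: prodr_ge0 => k _; exact: is_pmf_ge0.
have j0 e x : 0 <= joint (replace g i (point_mass R e)) x.
  by rewrite joint_replace mulr_ge0// ler0n.
rewrite PrE; last exact: is_pmf_replace.
under eq_eseriesr => e _.
  have -> : (p e * Pr (replace g i (point_mass R e)) A)%:E =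
      (\esum_(x in A) (p e * joint (replace g i (point_mass R e)) x)%:E)%E.
    (* [point_mass 0] is not a pmf in the sense of [is_pmf]. *)
    case: e => [|e].
      case: pP => _ -> _; rewrite mul0r esum1// => x _.
      by rewrite mul0r.
    rewrite EFinM PrE; last exact/is_pmf_replace/is_pmf_point_mass.
    by rewrite -esumZl// => x; rewrite lee_fin.
  over.
rewrite nneseries_esumT; last first.
  by move=> e; apply: esum_ge0 => x _; rewrite lee_fin mulr_ge0.
rewrite esum_esum; last by move=> *; rewrite lee_fin mulr_ge0.
(* Swapping the two components of the index pairs exchanges the order of summation. *)
rewrite (@reindex_esum _ _ _ (A `*`` (fun=> [set: nat]))%classic _
  (fun y => (y.2, y.1))); last first.
  split=> [[x e] [/= Ax _]//|[x e] [y f] _ _ [-> ->]//|[e x] [/= _ Ax]].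
  by exists (x, e).
rewrite -(@esum_esum _ _ _ A (fun=> setT) (fun x e =>
  (p e * joint (replace g i (point_mass R e)) x)%:E)); last first.
  by move=> *; rewrite lee_fin mulr_ge0.
apply: eq_esum => x _.
rewrite -nneseries_esumT; last by move=> e; rewrite lee_fin mulr_ge0.
rewrite (nneseriesD1 (n := x i))//; last by move=> e _; rewrite lee_fin mulr_ge0.
rewrite eseries0 => [|e _ /= ex]; last first.
  by rewrite joint_replace /point_mass eq_sym (negPf ex) mul0r mulr0.
by rewrite adde0 !joint_replace /point_mass eqxx mul1r.
Qed.

(** Overwriting coordinate [i] is a bijection between the slices [x i = e'] and [x i = e] of [A],
    and it preserves the mass contributed by the other players. The values may be 0, so every term
    of a series from 0 is covered. *)
Lemma Pr_point_mass g i e e' A :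
  (forall x y : {ffun 'I_n -> nat},
    (forall k, k != i -> x k = y k) -> A x -> A y) ->
  Pr (replace g i (point_mass R e)) A = Pr (replace g i (point_mass R e')) A.
Proof.
move=> AP.
pose upd (f : nat) (x : {ffun 'I_n -> nat}) : {ffun 'I_n -> nat} :=
  [ffun k => if k == i then f else x k].
have updA f x : A x -> A (upd f x).
  by apply: AP => k /negPf ki; rewrite ffunE ki.
(* The factor of [i] is 1 on the slice [x i = f] and 0 off it. *)
have E f : \esum_(x in A) (joint (replace g i (point_mass R f)) x)%:E =
    \esum_(x in (A `&` [set x | x i = f])%classic)
      (\prod_(k < n | k != i) g k (x k))%:E.
  rewrite esum_mkcondr; apply: eq_esum => x _.
  rewrite joint_replace /point_mass.
  have [xf|xf] := eqVneq (x i) f; first by rewrite mem_set// mul1r.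
  by rewrite memNset ?mul0r//=; apply/eqP.
rewrite /Pr -/(joint _) !E; congr fine.
rewrite (@reindex_esum _ _ _ (A `&` [set x | x i = e'])%classic _ (upd e)).
  apply: eq_esum => x _; congr EFin; apply: eq_bigr => k /negPf ki.
  by rewrite ffunE ki.
split=> [x [Ax _]|x y|x [Ax xe]] /=.
- by split; [exact: updA|rewrite ffunE eqxx].
- rewrite !inE => -[_ xe] [_ ye] xy; apply/ffunP => k.
  have := congr1 (fun f : {ffun _ -> _} => f k) xy; rewrite !ffunE.
  by case: eqP => [->|//]; rewrite xe ye.
- exists (upd e' x); first by split; [exact: updA|rewrite /= ffunE eqxx].
  by apply/ffunP => k; rewrite !ffunE; case: eqP => [->|].
Qed.

(** All conditional probabilities in the law of total probability agree, and their weights sum to 1.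
    The value 1 is an arbitrary reference, common to all laws [p]. *)
Lemma Pr_replace_indep g i p A : is_pmf_profile g -> is_pmf p ->
  (forall x y : {ffun 'I_n -> nat},
    (forall k, k != i -> x k = y k) -> A x -> A y) ->
  Pr (replace g i p) A = Pr (replace g i (point_mass R 1)) A.
Proof.
move=> gP pP AP; apply: EFin_inj; rewrite -Pr_replace//.
under eq_eseriesr => e _ do rewrite (Pr_point_mass g e 1 AP) mulrC EFinM.
rewrite nneseriesZl => [|e _]; last by rewrite lee_fin is_pmf_ge0.
by case: pP => _ _ ->; rewrite mule1.
Qed.

End JointLaw.

(** * Success probabilities, coalition values and expected rewards *)

Section Mechanism.

Variables (R : realType) (n m : nat) (grp : 'I_m -> {set 'I_n}) (d : R).
Implicit Types (a : assignment n m) (g : profile R n).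

Lemma success_unassigned a g i p : is_pmf_profile g -> is_pmf p ->
  ~~ assigned a i -> success d a (replace g i p) = success d a g.
Proof.
move=> gP pP ai.
have indep (x y : {ffun 'I_n -> nat}) : (forall k, k != i -> x k = y k) ->
    on_time d a x -> on_time d a y.
  move=> xy [ca]; split => //.
  rewrite (eq_bigr x)// => k ak; rewrite xy//.
  by apply: contraNneq ai => <-.
(* With [g] written as its own replacement at [i], both sides reduce to the same reference
   probability. *)
rewrite /success -[in RHS](replaceE g i).
by rewrite !(Pr_replace_indep _ _ indep).
Qed.

Lemma within_unassigned a i :
  assignment_within grp [set~ i]%SET a -> ~~ assigned a i.
Proof.
move=> /forallP aS; apply/existsPn => j; apply/negP => /eqP aj.
by have := aS j; rewrite aj !inE eqxx.
Qed.

Lemma assignment_withinS (S S' : {set 'I_n}) a :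
  S \subset S' -> assignment_within grp S a -> assignment_within grp S' a.
Proof.
move=> /fintype.subsetP SS' /forallP aS; apply/forallP => j; have := aS j.
by case: (a j) => // i /andP[/SS' -> ->].
Qed.

Lemma within_setC1 a i : assignment_within grp [set: 'I_n]%SET a ->
  ~~ assigned a i -> assignment_within grp [set~ i]%SET a.
Proof.
move=> /forallP aT /existsPn ai; apply/forallP => j.
have := aT j; have := ai j; case: (a j) => // k + /andP[_ ->].
by rewrite !inE andbT; apply: contraNN => /eqP ->.
Qed.

Lemma coalition_value_replace g i p : is_pmf_profile g -> is_pmf p ->
  coalition_value grp d [set~ i]%SET (replace g i p) =
  coalition_value grp d [set~ i]%SET g.
Proof.
move=> gP pP; apply: eq_bigr => a /within_unassigned ai.
exact: success_unassigned.
Qed.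

Lemma success_le_coalition_value (S : {set 'I_n}) a g :
  assignment_within grp S a -> success d a g <= coalition_value grp d S g.
Proof.
move=> aS; rewrite /coalition_value.
exact: (le_bigmax_cond _ (fun a => success d a g)).
Qed.

Lemma coalition_valueS (S S' : {set 'I_n}) g : S \subset S' ->
  coalition_value grp d S g <= coalition_value grp d S' g.
Proof.
move=> SS'; apply: bigmax_le => [|a aS]; first exact: bigmax_ge_id.
exact/success_le_coalition_value/(assignment_withinS SS').
Qed.

(** The series splits by linearity: total probability sums the first part, and [p] having mass 1
    sums the constant part. *)
Lemma vcgev_utility_assigned (pi : choice_rule R n m) i p g :
  is_pmf_profile g -> is_pmf p -> assigned (pi [set: 'I_n]%SET g) i ->
  vcgev_utility grp d pi i p g =
  success d (pi [set: 'I_n]%SET g) (replace g i p) -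
  coalition_value grp d [set~ i]%SET g.
Proof.
move=> gP pP ai; rewrite /vcgev_utility ai /vcgev_reward ai.
set a := pi _ g; set W := coalition_value _ _ _ _.
have [p0 p00 p1] := pP.
under eq_fun do under eq_bigr do rewrite mulrBr.
under eq_fun do rewrite sumrB -mulr_suml.
apply/cvg_lim => //; apply: cvgB.
  apply: cvg_nneseries_fin; last exact: Pr_replace.
    (* At 0 the point mass is not a pmf, but its weight [p 0] vanishes. *)
    case=> [|e]; first by rewrite p00 mul0r.
    by rewrite mulr_ge0// Pr_ge0//; exact/is_pmf_replace/is_pmf_point_mass.
  by rewrite p00 mul0r.
rewrite -[W in X in (_ --> X)%classic]mul1r; apply: cvgMl.
exact: cvg_nneseries_fin.
Qed.

End Mechanism.

Theorem theorem4 (R : realType) (n m : nat) (grp : 'I_m -> {set 'I_n}) (d : R)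
    (F : 'I_n -> set (nat -> R)) (pi : choice_rule R n m)
    (grpP : task_groups grp)
    (FP : forall i p, F i p -> is_pmf p)
    (piP : optimal_rule grp d F pi)
    (i : 'I_n) (f : profile R n) (f'i : nat -> R)
    (fF : in_domain F f) (f'iF : F i f'i) :
  vcgev_utility grp d pi i (f i) f >=
  vcgev_utility grp d pi i (f i) (replace f i f'i).
Proof.
set g := replace f i f'i.
have fP : is_pmf_profile f by move=> k; exact: FP (fF k).
have f'P : is_pmf f'i := FP _ _ f'iF.
have gP : is_pmf_profile g by exact: is_pmf_replace.
have gF : in_domain F g.
  by move=> k; rewrite /g /replace; case: eqP => [->|].
have [aT aopt] := piP [set: 'I_n]%SET f fF.
have [bT _] := piP [set: 'I_n]%SET g gF.
have WV : coalition_value grp d [set~ i]%SET f <=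
    coalition_value grp d [set: 'I_n]%SET f by exact/coalition_valueS/finset.subsetT.
(* The marginal contribution of [i] under the true profile separates the two utilities: truth
   attains at least this, a misreport at most this. *)
have truth : coalition_value grp d [set: 'I_n]%SET f -
    coalition_value grp d [set~ i]%SET f <= vcgev_utility grp d pi i (f i) f.
  have [ai|ai] := boolP (assigned (pi [set: 'I_n]%SET f) i).
    by rewrite vcgev_utility_assigned// replaceE aopt.
  rewrite /vcgev_utility (negPf ai) subr_le0 -aopt.
  exact/success_le_coalition_value/within_setC1.
apply: le_trans truth.
have [bi|bi] := boolP (assigned (pi [set: 'I_n]%SET g) i).
  (* Putting [f i] back into [g] restores [f], so the assignment chosen for [g] is just one
     competitor in the maximum under [f]. *)
  rewrite vcgev_utility_assigned// replaceK replaceE coalition_value_replace//.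
  by rewrite lerB// success_le_coalition_value.
(* A misreport that leaves [i] out earns 0, and the marginal contribution is nonnegative by [WV]. *)
by rewrite /vcgev_utility (negPf bi) subr_ge0.
Qed.
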